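(* Let $p:\mathbb{N}\to[0,1]$ be a function such that for every integer $k\ge 1$: (a) the limit $\lim_{n\to\infty} n^{2/k}p(n)$ exists in $[0,+\infty]$ and equals $0$ or $+\infty$, and (b) the limit $\lim_{n\to\infty} n^{2/k}(1-p(n))$ exists in $[0,+\infty]$ and equals $0$ or $+\infty$. Let $A$ be a first-order sentence over the vocabulary of images $\{C,U,R,D_1,D_2\}$, and let $\mathcal{I}_{n,p(n)}$ be a random image of size $n\times n$ and level $p(n)$. Then $$\lim_{n\to\infty}\mathrm{Prob}\left[\,\mathcal{I}_{n,p(n)}\models A\,\right]\ \text{ exists and equals } 0 \text{ or } 1 .$$
   Context: Images. For a positive integer $n$ let $X_n=\{1,\dots,n\}^2$ be the pixel set. Periodic boundary conditions are imposed: all additions of coordinates of pixels are taken modulo $n$ (identification $n+1\equiv 1$). An image of size $n\times n$ is a map $\eta:X_n\to\{0,1\}$ ($1$ = black, $0$ = white); $E_n$ is the set of all such images. For $p\in[0,1]$, $\mu_{n,p}$ is the probability measure on $E_n$ given by $\mu_{n,p}(\eta)=\prod_{i,j=1}^n p^{\eta(i,j)}(1-p)^{1-\eta(i,j)}$ (pixels are independent, black with probability $p$). A random image of size $n\times n$ and level $p$, denoted $\mathcal{I}_{n,p}$, is a random element of $E_n$ with distribution $\mu_{n,p}$. First-order logic on images. The vocabulary consists of one unary relation $C$ and four binary relations $U,R,D_1,D_2$. An image $\eta\in E_n$ is viewed as a structure with universe $X_n$ in which: $Cx$ holds iff $\eta(x)=1$; $Uxy$ holds iff $y=x+(0,1)$;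 $Rxy$ holds iff $y=x+(1,0)$; $D_1xy$ holds iff $y=x+(1,1)$; $D_2xy$ holds iff $y=x+(1,-1)$ (coordinates modulo $n$). First-order formulas are built as usual (with equality) from atoms using $\neg,\wedge,\forall$; variables range over pixels. A sentence is a formula without free variables. $\eta\models A$ means that $\eta$ satisfies the sentence $A$, and $\mathrm{Prob}[\mathcal{I}_{n,p}\models A]=\sum_{\eta\in E_n,\ \eta\models A}\mu_{n,p}(\eta)$. *)

(* Defs.v *)
From mathcomp Require Import all_boot all_order all_algebra.
From mathcomp Require Import boolp reals.

Set Implicit Arguments.
Unset Strict Implicit.
Unset Printing Implicit Defensive.

Import GRing.Theory.
Local Open Scope ring_scope.

(* Pixel coordinates range over {0, ..., n-1} rather than {1, ..., n}; [ordS]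
   and [ord_pred] are addition of 1 and of -1 modulo n.  [pixel 0] is empty,
   which does not affect limits as n tends to infinity. *)
Definition pixel (n : nat) : finType := ('I_n * 'I_n)%type.

(* [true] is black (1), [false] is white (0). *)
Definition image (n : nat) : finType := {ffun pixel n -> bool}.

(* The factor (1 - eta x)%N uses the coercion from bool to nat. *)
Definition mu (R : realType) (n : nat) (p : R) (eta : image n) : R :=
  \prod_(x : pixel n) (p ^+ eta x * (1 - p) ^+ (1 - eta x)%N).

Inductive binrel : Type := relU | relR | relD1 | relD2.

Inductive formula : Type :=
| FEq of nat & nat
| FC of nat
| FRel of binrel & nat & nat
| FNot of formula
| FAnd of formula & formula
| FForall of nat & formula.

Fixpoint free_vars (A : formula) : seq nat :=
  match A with
  | FEq i j => [:: i; j]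
  | FC i => [:: i]
  | FRel _ i j => [:: i; j]
  | FNot B => free_vars B
  | FAnd B D => free_vars B ++ free_vars D
  | FForall i B => [seq j <- free_vars B | j != i]
  end.

Definition sentence (A : formula) : Prop := free_vars A = [::].

Definition interp_binrel (n : nat) (r : binrel) (x y : pixel n) : Prop :=
  match r with
  | relU => y = (x.1, ordS x.2)
  | relR => y = (ordS x.1, x.2)
  | relD1 => y = (ordS x.1, ordS x.2)
  | relD2 => y = (ordS x.1, ord_pred x.2)
  end.

Fixpoint sat (n : nat) (eta : image n) (v : nat -> pixel n) (A : formula) :
    Prop :=
  match A with
  | FEq i j => v i = v j
  | FC i => eta (v i) = true
  | FRel r i j => interp_binrel r (v i) (v j)
  | FNot B => ~ sat eta v B
  | FAnd B D => sat eta v B /\ sat eta v D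
  | FForall i B => forall x : pixel n, sat eta [eta v with i |-> x] B
  end.

(* For a sentence and n >= 1 the choice of the assignment v is irrelevant. *)
Definition models (n : nat) (eta : image n) (A : formula) : Prop :=
  forall v : nat -> pixel n, sat eta v A.

Definition Prob (R : realType) (n : nat) (p : R) (A : formula) : R :=
  \sum_(eta : image n | `[< models eta A >]) mu p eta.

(* Main.v *)
Require Import Defs.
From mathcomp Require Import all_boot all_order all_algebra.
From mathcomp Require Import all_classical all_reals all_analysis.
From mathcomp Require Import zify ring lra.
Import Order.TTheory GRing.Theory Num.Theory.
Import numFieldNormedType.Exports.
Import Defs.
Local Open Scope classical_set_scope.
Local Open Scope ring_scope.

Set Implicit Arguments.
Unset Strict Implicit.
Unset Printing Implicit Defensive.

(** The truth of a first-order sentence in an image is decided by local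
information: it depends only on which square patterns of some fixed radius
occur, provided that every pattern that occurs does so in many places far from
one another. This is Hanf locality for a structure of bounded degree, proved
here by induction on the formula ([sat_agree]): two assignments that look alike
within radius [2 r] can be extended by one more pixel so as to look alike within
radius [r]. If the new pixel is close to an old one, copy the displacement; if
it is far from all of them, copy its pattern somewhere far from the old pixels.

A fixed pattern with [a] black and [b] white pixels occurs at a given place with
probability [q = p^a (1-p)^b]. The hypotheses say that [n^2 p^a] and [n^2
(1-p)^b] each tend to [0] or to infinity; since one of [p] and [1-p] is at least
[1/2], so does [n^2 q] ([zero_or_infinite_mul]). If [n^2 q] tends to [0], a
union bound over the [n^2] places shows that, with probability tending to [1],
the pattern does not occur. If [n^2 q] tends to infinity, cut the torus into
disjoint cells of the size of the pattern, sorted into [T+1] groups of order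
[n^2] cells each; the cells are independent, so that with probability tending to
[1] every group contains a copy of the pattern ([pr_cells_avoid]). Copies in
different groups are far apart, hence [T] given pixels always leave one of them
free.

So there is a set [S] of patterns such that, with probability tending to [1],
the patterns in [S] occur abundantly and the others do not occur at all. Any two
such images, even of different sizes, satisfy the same sentences of the given
radius and width; the sentence is then either true in all of them or false in
all of them, and its probability tends to [1] or to [0] accordingly. *)

(** * Translations of the torus *)

Definition shift m (x : pixel m.+1) (d : int * int) : pixel m.+1 :=
  (x.1 + Zp1 *~ d.1, x.2 + Zp1 *~ d.2).

Definition small (r : nat) (d : int * int) : bool :=
  (`|d.1| <= r)%N && (`|d.2| <= r)%N.

Lemma small_le r R d : (r <= R)%N -> small r d -> small R d.
Proof. by rewrite /small; lia. Qed.

Lemma smallD r R d e : small r d -> small R e -> small (r + R) (d + e).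
Proof. by case: d e => [d1 d2] [e1 e2]; rewrite /small /=; lia. Qed.

Lemma smallN r d : small r (- d) = small r d.
Proof. by case: d => d1 d2; rewrite /small /= !abszN. Qed.

Lemma smallB r d e : small r d -> small r e -> small r.*2 (d - e).
Proof. by move=> sd se; rewrite -addnn smallD ?smallN. Qed.

Lemma shift0 m (x : pixel m.+1) : shift x 0 = x.
Proof. by case: x => i j; rewrite /shift /= !mulr0z !addr0. Qed.

Lemma shiftD m (x : pixel m.+1) d e : shift (shift x d) e = shift x (d + e).
Proof. by rewrite /shift /= !mulrzDr !addrA. Qed.

Lemma shiftK m (x y : pixel m.+1) d e :
  shift x d = shift y e <-> x = shift y (e - d).
Proof.
split=> [|->]; last by rewrite shiftD subrK.
by rewrite -shiftD => <-; rewrite shiftD subrr shift0.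
Qed.

Lemma Zp1_mulz_eq0 m (z : int) :
  (`|z| <= m)%N -> (Zp1 : 'I_m.+1) *~ z = 0 -> z = 0.
Proof.
move=> zm z0; have: (Zp1 : 'I_m.+1) *+ `|z| = 0.
  case: z {zm} z0 => k; first by rewrite pmulrn.
  by rewrite NegzE mulrNz => /eqP; rewrite oppr_eq0 => /eqP.
rewrite Zp_mulrn => /(congr1 val) /=.
by rewrite modnMml mul1n modn_small //; lia.
Qed.

(** Displacements smaller than the side of the torus do not wrap around. *)
Lemma shift_free m r (x : pixel m.+1) d e :
  (r <= m)%N -> shift x d = shift x e -> small r (d - e) -> d = e.
Proof.
case: d e => [d1 d2] [e1 e2] rm E /andP[/= h1 h2].
have /addrI E1 := congr1 fst E; have /addrI E2 := congr1 snd E.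
congr (_, _); apply/eqP; rewrite -subr_eq0; apply/eqP.
  by apply: (@Zp1_mulz_eq0 m); [lia|rewrite mulrzBr E1 subrr].
by apply: (@Zp1_mulz_eq0 m); [lia|rewrite mulrzBr E2 subrr].
Qed.

Definition step (b : binrel) : int * int :=
  match b with
  | relU => (0, 1) | relR => (1, 0) | relD1 => (1, 1) | relD2 => (1, -1)
  end.

Lemma interp_binrelE m b (x y : pixel m.+1) :
  interp_binrel b x y <-> y = shift x (step b).
Proof.
have oS (i : 'I_m.+1) : ordS i = i + Zp1.
  by apply: val_inj; rewrite /= modnDmr addn1.
have oP (i : 'I_m.+1) : ord_pred i = i - Zp1.
  by apply/(canRL (addrK _)); rewrite -oS ord_predK.
by case: b x => [] [x1 x2]; rewrite /shift /= ?oS ?oP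
  ?mulr0z ?mulr1z ?mulrN1z ?addr0.
Qed.

(** * Locality of first-order logic *)

Definition agree (r : nat) (s : seq nat) m m'
    (eta : image m.+1) (v : nat -> pixel m.+1)
    (eta' : image m'.+1) (v' : nat -> pixel m'.+1) : Prop :=
  (forall i d, i \in s -> small r d ->
     eta (shift (v i) d) = eta' (shift (v' i) d)) /\
  (forall i j d, i \in s -> j \in s -> small r d ->
     v j = shift (v i) d <-> v' j = shift (v' i) d).

(** The far move of the back-and-forth game: the surroundings of any pixel of
the first image can be found in the second one away from any [T] given pixels. *)
Definition extends (R T : nat) m m' (eta : image m.+1) (eta' : image m'.+1) :=
  forall (x : pixel m.+1) (ys : seq (pixel m'.+1)), (size ys <= T)%N ->
  exists x' : pixel m'.+1,
    (forall d, small R d -> eta (shift x d) = eta' (shift x' d)) /\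
    (forall y d, y \in ys -> small R d -> x' <> shift y d).

(** Each quantifier doubles the radius: a new pixel within distance [r] of an
old one has its [r]-neighbourhood inside the [2 r]-neighbourhood of the old
one. *)
Fixpoint radius (A : formula) : nat :=
  match A with
  | FNot B => radius B
  | FAnd B D => maxn (radius B) (radius D)
  | FForall _ B => (radius B).*2
  | _ => 1
  end.

(** The number of pixels that may already be placed when a quantifier is met. *)
Fixpoint width (A : formula) : nat :=
  match A with
  | FNot B => width B
  | FAnd B D => maxn (width B) (width D)
  | FForall _ B => maxn (size (free_vars A)) (width B)
  | _ => 0
  end.

Lemma agree_sub r R s t m m' (eta : image m.+1) v (eta' : image m'.+1) v' :
  (r <= R)%N -> {subset s <= t} ->
  agree R t eta v eta' v' -> agree r s eta v eta' v'.
Proof.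
move=> rR st [c e]; split=> [i d si sd|i j d si sj sd].
  by apply: c; [exact: st|exact: small_le sd].
by apply: e; [exact: st|exact: st|exact: small_le sd].
Qed.

Lemma agree_sym r s m m' (eta : image m.+1) v (eta' : image m'.+1) v' :
  agree r s eta v eta' v' -> agree r s eta' v' eta v.
Proof.
move=> [c e]; split=> [i d si sd|i j d si sj sd]; first by rewrite c.
by rewrite e.
Qed.

(** One round of the game.  A pixel [x] within distance [r] of an assigned pixel
is answered by the same displacement from the matching pixel; any other [x] is
answered by a far copy of its pattern, so that no relation at distance at most
[r] holds on either side. *)
Lemma agree_extend r R T s k m m'
    (eta : image m.+1) v (eta' : image m'.+1) v' x :
  (r.*2 <= R)%N -> (R <= m)%N -> (R <= m')%N -> (size s <= T)%N ->
  k \notin s ->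
  extends R T eta eta' -> agree r.*2 s eta v eta' v' ->
  exists x', agree r (k :: s) eta [eta v with k |-> x]
                              eta' [eta v' with k |-> x'].
Proof.
move=> rR Rm Rm' sT ks ext [c e].
pose near := exists j d, [/\ j \in s, small r d & x = shift (v j) d].
suff [x' [cx ex]] : exists x',
    (forall d, small r d -> eta (shift x d) = eta' (shift x' d)) /\
    (forall j d, j \in s -> small r d ->
       x = shift (v j) d <-> x' = shift (v' j) d).
  (* The old pixels are governed by [c] and [e], the new one by [cx] and [ex];
     the remaining pair is the new pixel with itself. *)
  have self n (y : pixel n.+1) d : (R <= n)%N -> small r d ->
      y = shift y d <-> d = 0.
    move=> Rn sd; split=> [|->]; last by rewrite shift0.
    rewrite -{1}[y]shift0 => /(@shift_free n R) -> //.
    by rewrite sub0r smallN; apply: small_le sd; lia.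
  have sk i : i \in k :: s -> i <> k -> i \in s.
    by rewrite inE => /orP[/eqP|].
  exists x'; split=> [i d si|i j d si sj] sd /=.
    case: eqP => [_|/(sk _ si) {}si]; first exact: cx.
    by apply: c => //; apply: small_le sd; lia.
  case: eqP => [_|/(sk _ sj) {}sj]; case: eqP => [_|/(sk _ si) {}si].
  - by rewrite !self.
  - exact: ex.
  - have := ex j (- d) sj; rewrite smallN => /(_ sd).
    rewrite -(sub0r d) -!shiftK !shift0.
    by move=> h; split=> /esym/h/esym.
  - by apply: e => //; apply: small_le sd; lia.
have [[j [d [sj sd ->]]]|far] := pselect near.
  exists (shift (v' j) d); split=> [f sf|l f sl sf].
    by rewrite !shiftD; apply: c; rewrite -?addnn ?smallD.
  by rewrite !shiftK; apply: e => //; exact: smallB.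
have [|x' [cx ex]] := ext x [seq v' j | j <- s]; first by rewrite size_map.
exists x'; split=> [d sd|j d sj sd].
  by apply: cx; apply: small_le sd; lia.
split=> [h|h]; first by case: far; exists j, d.
case: (ex (v' j) d) => //; first exact: map_f.
by apply: small_le sd; lia.
Qed.

(** The game is played in both directions, since negation turns a universal
quantifier into an existential one. *)
Lemma sat_agree R T m m' (eta : image m.+1) (eta' : image m'.+1) A v v' :
  (radius A <= R)%N -> (width A <= T)%N -> (R <= m)%N -> (R <= m')%N ->
  extends R T eta eta' -> extends R T eta' eta ->
  agree (radius A) (free_vars A) eta v eta' v' ->
  sat eta v A <-> sat eta' v' A.
Proof.
move=> rR wT Rm Rm' ext ext'.
elim: A v v' rR wT => [i j|i|b i j|B IH|B IHB D IHD|i B IH] v v' /= rR wT ag.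
- have [_ /(_ j i 0)] := ag; rewrite !shift0; apply=> //;
    by rewrite !inE eqxx ?orbT.
- have [/(_ i 0)] := ag; rewrite !shift0 => -> //.
  by rewrite !inE.
- have [_ e] := ag; rewrite !interp_binrelE.
  by apply: e; rewrite ?inE ?eqxx ?orbT //; case: b.
- by rewrite (IH v v').
- rewrite (IHB v v') ?(IHD v v') //; try lia;
    apply: agree_sub ag; rewrite ?leq_maxr ?leq_maxl //;
    by move=> x; rewrite mem_cat => ->; rewrite ?orbT.
have sub : {subset free_vars B <= i :: [seq j <- free_vars B | j != i]}.
  by move=> x xB; rewrite inE mem_filter xB andbT orbN.
have ni : i \notin [seq j <- free_vars B | j != i] by rewrite mem_filter eqxx.
move: wT; rewrite geq_max => /andP[wF wB].
have rB : (radius B <= R)%N by rewrite (leq_trans _ rR) // -addnn leq_addr.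
split=> h x.
  have [x' ag'] := agree_extend x rR Rm' Rm wF ni ext' (agree_sym ag).
  exact/(IH _ _ rB wB (agree_sym (agree_sub (leqnn _) sub ag')))/h.
have [x' ag'] := agree_extend x rR Rm Rm' wF ni ext ag.
exact/(IH _ _ rB wB (agree_sub (leqnn _) sub ag'))/h.
Qed.

Lemma models_extends R T m m' (eta : image m.+1) (eta' : image m'.+1) A :
  sentence A -> (radius A <= R)%N -> (width A <= T)%N ->
  (R <= m)%N -> (R <= m')%N ->
  extends R T eta eta' -> extends R T eta' eta ->
  models eta A -> models eta' A.
Proof.
move=> hA rR wT Rm Rm' ext ext' mA v'.
apply/(sat_agree (v := fun=> (0, 0)) rR wT Rm Rm' ext ext'); last exact: mA.
by rewrite hA.
Qed.

(** * Patterns and cells *)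

Definition pattern (R : nat) : finType :=
  {ffun 'I_R.*2.+1 * 'I_R.*2.+1 -> bool}.

Definition centered (R : nat) (d : 'I_R.*2.+1 * 'I_R.*2.+1) : int * int :=
  ((d.1 : nat)%:Z - R%:Z, (d.2 : nat)%:Z - R%:Z).

Arguments centered : clear implicits.

Definition occurs R (P : pattern R) m (eta : image m.+1) (x : pixel m.+1) :=
  [forall d, eta (shift x (centered R d)) == P d].

(** The squares of radius [R] around these pixels are the cells.  A column of
[T + 1] blocks, each of [L x L] cells, is laid out from the origin; [g] is the
block and [c] the position of the cell in it. *)
Definition cell_center R T L m (g : 'I_T.+1) (c : 'I_L * 'I_L) : pixel m.+1 :=
  shift (ord0, ord0) (((g * L + c.1) * R.*2.+1 + R)%N%:Z,
                      (c.2 * R.*2.+1 + R)%N%:Z).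

Lemma small_centered R e : small R e -> exists d, centered R d = e.
Proof.
case: e => [e1 e2] /andP[/= h1 h2].
have l1 : (`|(e1 + R%:Z)%R| < R.*2.+1)%N by lia.
have l2 : (`|(e2 + R%:Z)%R| < R.*2.+1)%N by lia.
by exists (Ordinal l1, Ordinal l2); congr (_, _) => /=; lia.
Qed.

Lemma centered_inj R : injective (centered R).
Proof.
by move=> [a b] [c d] [e1 e2]; congr (_, _); apply: val_inj => /=; lia.
Qed.

Lemma centered_small R d : small R (centered R d).
Proof.
case: d => [[a ha] [b hb]]; rewrite /small /centered /=; lia.
Qed.

Lemma radix_inj w a d a' d' : (d < w)%N -> (d' < w)%N ->
  (a * w + d = a' * w + d')%N -> a = a' /\ d = d'.
Proof.
move=> dw dw' e; have w0 : (0 < w)%N by lia.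
have := congr1 (modn^~ w) e; have := congr1 (divn^~ w) e.
by rewrite !divnMDl // !modnMDl !divn_small // !addn0 !modn_small.
Qed.

(** The coordinates of a pixel of a cell are numbers below [m.+1], written in
the mixed radix [L], [2 R + 1]; so they determine the cell and the offset in
it. *)
Lemma cells_disjoint R T L m (g g' : 'I_T.+1) (c c' : 'I_L * 'I_L) d d' :
  (T.+1 * L * R.*2.+1 <= m.+1)%N ->
  shift (cell_center R m g c) (centered R d)
    = shift (cell_center R m g' c') (centered R d') ->
  [/\ g = g', c = c' & d = d'].
Proof.
move=> hm.
have bnd (a e L' : nat) : (a < L')%N -> (L' <= T.+1 * L)%N -> (e < R.*2.+1)%N ->
    (a * R.*2.+1 + e <= m)%N.
  move=> aL LL ew; rewrite -ltnS (leq_trans _ hm) //.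
  have aT : (a.+1 <= T.+1 * L)%N by exact: leq_trans LL.
  by apply: leq_trans (leq_mul aT (leqnn _)); rewrite mulSn addnC ltn_add2r.
have gL (h : 'I_T.+1) (i : 'I_L) : (h * L + i < T.+1 * L)%N.
  apply: (@leq_trans (h.+1 * L)); last by rewrite leq_mul2r ltn_ord orbT.
  by rewrite mulSn addnC ltn_add2r.
have lL (i : 'I_L) : (i < L)%N by [].
have LT : (L <= T.+1 * L)%N by rewrite leq_pmull.
case: c c' d d' => [c1 c2] [c1' c2'] [d1 d2] [d1' d2'].
have b1 := bnd _ _ _ (gL g c1) (leqnn _) (ltn_ord d1).
have b1' := bnd _ _ _ (gL g' c1') (leqnn _) (ltn_ord d1').
have b2 := bnd _ _ _ (lL c2) LT (ltn_ord d2).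
have b2' := bnd _ _ _ (lL c2') LT (ltn_ord d2').
rewrite /cell_center /centered !shiftD /=.
move=> /(shift_free (leqnn _))/(_ _)/wrap[|[e1 e2]].
  by rewrite /small /=; lia.
have [|||/radix_inj[//|//|eg ec1] ed1] :=
  @radix_inj R.*2.+1 (g * L + c1) d1 (g' * L + c1') d1'; rewrite ?ltn_ord //.
  by lia.
have [|||ec2 ed2] := @radix_inj R.*2.+1 c2 d2 c2' d2'; rewrite ?ltn_ord //.
  by lia.
by split; [|congr (_, _)|congr (_, _)]; exact: val_inj.
Qed.

(** Patterns of [S] are required in every one of the [T + 1] blocks, which is
how abundance far from any [T] pixels is expressed. *)
Definition typical R T L (S : {set pattern R}) m (eta : image m.+1) :=
  [forall P, if P \in S
    then [forall g : 'I_T.+1, [exists c : 'I_L * 'I_L,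
            occurs P eta (cell_center R m g c)]]
    else [forall x, ~~ occurs P eta x]].

(** Pigeonhole: a pixel lies in at most one cell, so [T] pixels cannot spoil the
copies found in [T + 1] different blocks. *)
Lemma typical_extends R T L L' (S : {set pattern R}) m m'
    (eta : image m.+1) (eta' : image m'.+1) :
  (T.+1 * L' * R.*2.+1 <= m'.+1)%N ->
  typical T L S eta -> typical T L' S eta' -> extends R T eta eta'.
Proof.
move=> hm' /forallP G /forallP G' x ys sys.
pose P : pattern R := [ffun d => eta (shift x (centered R d))].
have occP : occurs P eta x by apply/forallP => d; rewrite ffunE.
have PS : P \in S.
  by have := G P; case: ifP => // _ /forallP/(_ x); rewrite occP.
have := G' P; rewrite PS => /forallP occ'.
have /choice[c cP] : forall g : 'I_T.+1, exists c : 'I_L' * 'I_L',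
    occurs P eta' (cell_center R m' g c) by move=> g; exact/existsP.
have [[g far]|near] := pselect (exists g, forall y d,
    y \in ys -> small R d -> cell_center R m' g (c g) <> shift y d).
  exists (cell_center R m' g (c g)); split=> // e /small_centered[d <-].
  by have /forallP/(_ d)/eqP -> := cP g; rewrite ffunE.
(* Otherwise the chosen cell of each block [g] contains some [y g] from [ys]. *)
have /choice[y yP] : forall g : 'I_T.+1, exists y,
    y \in ys /\ exists d, y = shift (cell_center R m' g (c g)) (centered R d).
  move=> g; apply: contrapT => no; apply: near; exists g => y e yys se eq.
  apply: no; exists y; split=> //.
  have [d dE] : exists d, centered R d = - e.
    by apply: small_centered; rewrite smallN.
  by exists d; rewrite dE eq shiftD subrr shift0.
have y_inj : injective y.
  move=> g g' e; have [_ [d yd]] := yP g; have [_ [d' yd']] := yP g'.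
  by have [] := cells_disjoint hm' (etrans (esym yd) (etrans e yd')).
have /uniq_leq_size : uniq [seq y g | g <- enum 'I_T.+1].
  by rewrite map_inj_uniq ?enum_uniq.
move=> /(_ ys) /(_ _)/wrap[z /mapP[g _ ->]|]; first by have [] := yP g.
by rewrite size_map size_enum_ord => /leq_trans/(_ sys); rewrite ltnn.
Qed.

(** * Independence of pixels *)

Definition rho (F : realType) (p : F) (b : bool) : F := if b then p else 1 - p.

Definition pr (F : realType) (p : F) n (E : pred (image n)) : F :=
  \sum_(eta | E eta) mu p eta.

Definition pattern_pr (F : realType) (p : F) R (P : pattern R) : F :=
  \prod_d rho p (P d).

Section Probability.
Variables (F : realType) (p : F).
Hypothesis p01 : 0 <= p <= 1.

Lemma rho01 b : 0 <= rho p b <= 1.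
Proof.
case/andP: p01 => p0 p1.
by case: b; rewrite /rho ?p0 ?p1 // subr_ge0 p1 gerBl.
Qed.

Lemma rho_ge0 b : 0 <= rho p b.
Proof. by have /andP[] := rho01 b. Qed.

Lemma muE n (eta : image n) : mu p eta = \prod_x rho p (eta x).
Proof.
apply: eq_bigr => x _.
by case: (eta x); rewrite /= ?expr1 ?expr0 ?mulr1 ?mul1r.
Qed.

Lemma mu_ge0 n (eta : image n) : 0 <= mu p eta.
Proof. by rewrite muE prodr_ge0 // => x _; exact: rho_ge0. Qed.

Lemma pr_ge0 n (E : pred (image n)) : 0 <= pr p E.
Proof. by apply: sumr_ge0 => eta _; exact: mu_ge0. Qed.

Lemma pattern_pr_ge0 R (P : pattern R) : 0 <= pattern_pr p P.
Proof. by rewrite prodr_ge0 // => x _; exact: rho_ge0. Qed.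

Lemma pattern_pr_le1 R (P : pattern R) : pattern_pr p P <= 1.
Proof. by apply: prodr_ile1 => x _; exact: rho01. Qed.

(** Independence: the colors of distinct pixels [h i] are prescribed with the
product of their probabilities.  The product over [I] is regrouped pixel by
pixel, and then the sum over images factors. *)
Lemma mean_pinned n (I : finType) (Q : pred I) (h : I -> pixel n)
    (t : I -> bool) : injective h ->
  \sum_eta mu p eta * \prod_(i | Q i) (eta (h i) == t i)%:R
  = \prod_(i | Q i) rho p (t i).
Proof.
move=> h_inj.
pose f x b : F := rho p b * \prod_(i | Q i && (h i == x)) (b == t i)%:R.
have -> : \sum_eta mu p eta * \prod_(i | Q i) (eta (h i) == t i)%:R
        = \sum_(eta : image n) \prod_x f x (eta x).
  apply: eq_bigr => eta _; rewrite muE big_split /=; congr (_ * _).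
  rewrite (partition_big h predT) //=.
  by apply: eq_bigr => x _; apply: eq_bigr => i /andP[_ /eqP ->].
rewrite -(bigA_distr_bigA f) (partition_big h predT) //=.
apply: eq_bigr => x _; rewrite /f big_bool /=.
(* The fibre of [h] over [x] has at most one element, as [h] is injective. *)
have [[i /andP[Qi /eqP hi]]|no] := pselect (exists i, Q i && (h i == x)).
  have one j : Q j && (h j == x) = (j == i).
    rewrite -hi; apply/andP/eqP => [[_ /eqP/h_inj]|->] //.
  rewrite !(eq_bigl _ _ one) !big_pred1_eq.
  by case: (t i); rewrite /= ?mulr1 ?mulr0 ?addr0 ?add0r.
rewrite !big_pred0; first by rewrite /=; ring.
all: by move=> j; apply/negP => hj; apply: no; exists j.
Qed.

Lemma pr_union n (I : finType) (E : pred (image n)) (B : I -> pred (image n)) :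
  (forall eta, E eta -> exists i, B i eta) -> pr p E <= \sum_i pr p (B i).
Proof.
move=> EB; rewrite /pr (exchange_big_dep predT) //=.
rewrite [leLHS]big_mkcond; apply: ler_sum => eta _.
case: ifP => [/EB[i Bi]|_]; last by apply: sumr_ge0 => i _; exact: mu_ge0.
by rewrite (bigD1 i) //= lerDl sumr_ge0 // => j _; exact: mu_ge0.
Qed.

(** The total mass is the mean of the empty prescription of colors. *)
Lemma prC n (E : pred (image n)) : pr p E = 1 - pr p (predC E).
Proof.
have void_inj : injective (of_void (pixel n)) by case.
have := mean_pinned pred0 (of_void bool) void_inj.
rewrite big_pred0 // => <-; rewrite (bigID E) /=.
have mu1 (D : pred (image n)) : \sum_(eta | D eta) mu p eta *
    \prod_(i : void | pred0 i) (eta (of_void _ i) == of_void bool i)%:R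
    = pr p D.
  by apply: eq_bigr => eta _; rewrite big_pred0 // mulr1.
by rewrite (mu1 E) (mu1 (predC E)) addrK.
Qed.

Lemma occurs_indicator R (P : pattern R) m (eta : image m.+1) x :
  (occurs P eta x)%:R = \prod_d (eta (shift x (centered R d)) == P d)%:R :> F.
Proof.
case: (boolP (occurs P eta x)) => [/forallP h|/forallPn[d /negbTE h]].
  by rewrite big1 // => d _; rewrite h.
by rewrite (bigD1 d) //= h mul0r.
Qed.

Lemma pr_mean n (E : pred (image n)) :
  pr p E = \sum_eta mu p eta * (E eta)%:R.
Proof.
by rewrite /pr big_mkcond; apply: eq_bigr => eta _;
  case: (E eta); rewrite ?mulr1 ?mulr0.
Qed.

Lemma pr_occurs R (P : pattern R) m x : (R.*2 <= m)%N ->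
  pr p (fun eta : image m.+1 => occurs P eta x) = pattern_pr p P.
Proof.
move=> Rm; rewrite pr_mean.
under eq_bigr do rewrite occurs_indicator.
rewrite mean_pinned // => d e /(shift_free Rm) h.
by apply: centered_inj; apply: h; apply: smallB; exact: centered_small.
Qed.

(** Expand [\prod_c (1 - Z c)], where [Z c] indicates that the pattern fills the
cell [c], over the sets [J] of cells.  Disjointness of the cells gives the mean
[q ^ #|J|] to each product of [Z c] over [J], and the expansion folds back. *)
Lemma pr_cells_avoid R T L (P : pattern R) m (g : 'I_T.+1) :
  (T.+1 * L * R.*2.+1 <= m.+1)%N ->
  pr p (fun eta : image m.+1 =>
          [forall c : 'I_L * 'I_L, ~~ occurs P eta (cell_center R m g c)])
  = (1 - pattern_pr p P) ^+ (L * L).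
Proof.
move=> hm; rewrite pr_mean.
pose Z (eta : image m.+1) (c : 'I_L * 'I_L) : F :=
  (occurs P eta (cell_center R m g c))%:R.
have ZE eta :
    ([forall c : 'I_L * 'I_L, ~~ occurs P eta (cell_center R m g c)])%:R
    = \sum_(J : {set 'I_L * 'I_L}) (-1) ^+ #|J| * \prod_(c in J) Z eta c.
  transitivity (\prod_c (- Z eta c + 1)).
    case: forallP => [h|/forallP/forallPn[c /negbNE h]].
      by rewrite big1 // => c _; rewrite /Z (negbTE (h c)) oppr0 add0r.
    by rewrite (bigD1 c) //= /Z h addNr mul0r.
  rewrite bigA_distr; apply: eq_bigr => J _.
  rewrite -big_mkcond /= -prodrN.
  by apply: eq_bigr.
under eq_bigr do rewrite ZE mulr_sumr.
rewrite exchange_big /=.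
have mJ (J : {set 'I_L * 'I_L}) :
    \sum_eta mu p eta * \prod_(c in J) Z eta c = pattern_pr p P ^+ #|J|.
  pose h (cd : ('I_L * 'I_L) * _) :=
    shift (cell_center R m g cd.1) (centered R cd.2).
  have h_inj : injective h.
    by move=> [c d] [c' d'] /(cells_disjoint hm)[_ /= -> ->].
  have split (G : 'I_L * 'I_L -> 'I_R.*2.+1 * 'I_R.*2.+1 -> F) :
      \prod_(cd | cd.1 \in J) G cd.1 cd.2 = \prod_(c in J) \prod_d G c d.
    by rewrite pair_big /=; apply: eq_bigl => cd; rewrite andbT.
  have := mean_pinned (fun cd => cd.1 \in J) (fun cd => P cd.2) h_inj.
  rewrite (split (fun _ d => rho p (P d))) prodr_const => <-.
  apply: eq_bigr => eta _; congr (_ * _).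
  rewrite (split (fun c d =>
    (eta (shift (cell_center R m g c) (centered R d)) == P d)%:R)).
  by apply: eq_bigr => c _; exact: occurs_indicator.
transitivity (\prod_(c : 'I_L * 'I_L) (- pattern_pr p P + 1)).
  rewrite bigA_distr; apply: eq_bigr => J _.
  under eq_bigr do rewrite mulrCA.
  by rewrite -mulr_sumr mJ -big_mkcond /= prodr_const [in RHS]exprNn.
by rewrite prodr_const card_prod card_ord addrC.
Qed.

End Probability.

(** The first moment bounds the probability that a pattern outside [S] occurs;
independence of the cells gives the probability that one in [S] misses a
block. *)
Lemma pr_not_typical (F : realType) (p : F) R T L (S : {set pattern R}) m :
  0 <= p <= 1 -> (R.*2 <= m)%N -> (T.+1 * L * R.*2.+1 <= m.+1)%N ->
  pr p (predC (@typical R T L S m)) <=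
  \sum_P if P \in S then T.+1%:R * (1 - pattern_pr p P) ^+ (L * L)
         else m.+1%:R ^+ 2 * pattern_pr p P.
Proof.
move=> p01 Rm hm.
pose bad (P : pattern R) (eta : image m.+1) := ~~ (if P \in S
    then [forall g : 'I_T.+1, [exists c : 'I_L * 'I_L,
            occurs P eta (cell_center R m g c)]]
    else [forall x, ~~ occurs P eta x]).
apply: (le_trans (pr_union p01 (B := bad) _)).
  by move=> eta /forallPn.
apply: ler_sum => P _; rewrite /bad; case: ifP => _.
  apply: (le_trans (pr_union p01 (B := fun (g : 'I_T.+1) eta =>
    [forall c : 'I_L * 'I_L, ~~ occurs P eta (cell_center R m g c)]) _)).
    by move=> eta /forallPn[g]; rewrite negb_exists; exists g.
  under eq_bigr do rewrite pr_cells_avoid //.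
  by rewrite sumr_const card_ord mulr_natl.
apply: (le_trans (pr_union p01
  (B := fun (x : pixel m.+1) eta => occurs P eta x) _)).
  by move=> eta /forallPn[x]; rewrite negbK; exists x.
under eq_bigr do rewrite pr_occurs //.
by rewrite sumr_const card_prod card_ord expr2 -natrM mulr_natl.
Qed.

(** * Asymptotics *)

Section Limits.
Variables (F : realType).
Implicit Types (u p : nat -> F).

Definition zero_or_infinite u :=
  (u n @[n --> \oo] --> (0 : F)) \/ (u n @[n --> \oo] --> +oo).

(** [n^2 p^k] is the [k]-th power of [n^(2/k) p]. *)
Lemma zero_or_infinite_power p k : (forall n, 0 <= p n) -> (0 < k)%N ->
  ((n%:R `^ (2 / k%:R) * p n)%:E @[n --> \oo] --> 0%E) \/
  ((n%:R `^ (2 / k%:R) * p n)%:E @[n --> \oo] --> +oo%E) ->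
  zero_or_infinite (fun n => n%:R ^+ 2 * p n ^+ k).
Proof.
move=> p0 k0.
have E n : n%:R ^+ 2 * p n ^+ k = (n%:R `^ (2 / k%:R) * p n) ^+ k.
  rewrite exprMn -[in RHS]powR_mulrn ?powR_ge0 // -powRrM.
  by rewrite divfK ?pnatr_eq0 -?lt0n // powR_mulrn.
have x0 n : 0 <= n%:R `^ (2 / k%:R) * p n by rewrite mulr_ge0 ?powR_ge0.
case=> [/fine_cvg|/cvgeryP] h; [left|right].
  have -> : 0 = (0 : F) ^+ k by rewrite expr0n gtn_eqF.
  under eq_fun do rewrite E.
  exact: (cvg_comp _ _ h (@exprn_continuous F k 0)).
apply/cvgryPge => A; move/cvgryPge: h => /(_ (Num.max A 1)).
apply: filterS => n; rewrite ge_max E => /andP[hA h1].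
by rewrite (le_trans hA) // ler_eXnr.
Qed.

Lemma pattern_prE (q : F) R (P : pattern R) :
  pattern_pr q P =
  q ^+ #|[pred d | P d]| * (1 - q) ^+ #|[pred d | ~~ P d]|.
Proof.
rewrite /pattern_pr (bigID P) /= -!prodr_const.
by congr (_ * _); apply: eq_bigr => d;
  rewrite /rho; [move=> ->|move=> /negbTE ->].
Qed.

Lemma sqr_natr_cvgy : (n%:R : F) ^+ 2 @[n --> \oo] --> +oo.
Proof.
apply/cvgryPge => A; have := nbhs_infty_ger (Num.max A 1).
apply: filterS => n; rewrite ge_max => /andP[hA h1].
by rewrite (le_trans hA) // ler_eXnr.
Qed.

(** When both factors are infinite, the larger of [p] and [1 - p] is at least
[1/2] and costs only a constant. *)
Lemma zero_or_infinite_mul p a b : (forall n, 0 <= p n <= 1) ->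
  zero_or_infinite (fun n => n%:R ^+ 2 * p n ^+ a) ->
  zero_or_infinite (fun n => n%:R ^+ 2 * (1 - p n) ^+ b) ->
  zero_or_infinite (fun n => n%:R ^+ 2 * (p n ^+ a * (1 - p n) ^+ b)).
Proof.
move=> p01.
have p0 n : 0 <= p n by case/andP: (p01 n).
have p1 n : p n <= 1 by case/andP: (p01 n).
have q0 n : 0 <= 1 - p n by rewrite subr_ge0.
have q1 n : 1 - p n <= 1 by rewrite gerBl.
have n0 n : 0 <= n%:R ^+ 2 :> F by rewrite exprn_ge0.
have squeeze u v : v n @[n --> \oo] --> (0 : F) ->
    (forall n, 0 <= u n <= v n) -> u n @[n --> \oo] --> (0 : F).
  move=> v0 uv; apply: squeeze_cvgr (cvg_cst 0) v0.
  by apply: nearW.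
case=> [ha|ha].
  move=> _; left; apply: squeeze ha _ => n.
  rewrite !mulr_ge0 ?exprn_ge0 //= ler_wpM2l //.
  by rewrite ler_piMr ?exprn_ge0 ?exprn_ile1.
case=> hb; [left|right].
  apply: squeeze hb _ => n.
  rewrite !mulr_ge0 ?exprn_ge0 //= ler_wpM2l //.
  by rewrite ler_piMl ?exprn_ge0 ?exprn_ile1.
apply/cvgryPge => A; pose A' := Num.max A 0.
have A'0 : 0 <= A' by rewrite le_max lexx orbT.
have AA' : A <= A' by rewrite le_max lexx.
have halves (x : F) k : 1 / 2 <= x -> 1 <= 2 ^+ k * x ^+ k.
  by move=> hx; rewrite -exprMn exprn_ege1 //; lra.
move/cvgryPge: ha => /(_ (A' * 2 ^+ b)) ha.
move/cvgryPge: hb => /(_ (A' * 2 ^+ a)) hb.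
apply: filterS2 ha hb => n ha hb; apply: (le_trans AA').
have big (x y s : F) k : 0 <= y -> 0 <= s -> 1 / 2 <= x ->
    A' * 2 ^+ k <= s * y -> A' <= s * (y * x ^+ k).
  move=> y0 s0 hx h.
  have xk0 : 0 <= x ^+ k by rewrite exprn_ge0 //; lra.
  apply: le_trans (_ : A' * (2 ^+ k * x ^+ k) <= _).
    by rewrite ler_peMr // halves.
  by rewrite !mulrA ler_wpM2r.
case: (lerP (1 / 2) (p n)) => hp; last first.
  by apply: big; rewrite ?exprn_ge0 //; lra.
by rewrite [X in _ * X]mulrC; apply: big; rewrite ?exprn_ge0.
Qed.

(** By Bernoulli's inequality, as [(1 - q) (1 + q) <= 1]. *)
Lemma one_sub_exp_le (q : F) N : 0 <= q <= 1 ->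
  (1 - q) ^+ N <= (1 + N%:R * q)^-1.
Proof.
move=> /andP[q0 q1].
have bern : 1 + N%:R * q <= (1 + q) ^+ N.
  elim: N => [|N IH]; first by rewrite mul0r addr0 expr0.
  have Nq : 0 <= N%:R * q by rewrite mulr_ge0.
  rewrite exprS; apply: le_trans (_ : (1 + q) * (1 + N%:R * q) <= _).
    have Nqq : 0 <= N%:R * q * q by rewrite mulr_ge0.
    by rewrite -natr1; lra.
  by rewrite ler_wpM2l // addr_ge0.
have pos : 0 < 1 + N%:R * q by rewrite ltr_wpDr // mulr_ge0.
rewrite -[leRHS]mul1r ler_pdivlMr //.
apply: le_trans (_ : (1 - q) ^+ N * (1 + q) ^+ N <= _).
  by rewrite ler_wpM2l // exprn_ge0 // subr_ge0.
by rewrite -exprMn exprn_ile1 //; nra.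
Qed.

(** For [n >= c], the number [(n %/ c)^2] of cells in a block is at least
[n^2 / (2 c)^2], so the expected number of copies in it still tends to
infinity. *)
Lemma blocks_cvg0 (q : nat -> F) c t : (0 < c)%N -> (forall n, 0 <= q n <= 1) ->
  n%:R ^+ 2 * q n @[n --> \oo] --> +oo ->
  t%:R * (1 - q n) ^+ (n %/ c * (n %/ c)) @[n --> \oo] --> (0 : F).
Proof.
move=> c0 q01 /cvgryPge h; apply/cvgrPdist_le => e e0.
have c0F : (0 : F) < c%:R by rewrite ltr0n.
have := nbhs_infty_ge c; move: (h (t%:R / e * (2 * c%:R) ^+ 2)).
apply: filterS2 => n hn cn; have /andP[qn0 qn1] := q01 n.
rewrite sub0r normrN ger0_norm; last first.
  by rewrite mulr_ge0 // exprn_ge0 // subr_ge0.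
set L := (n %/ c)%N.
have nL : (n <= L * (2 * c))%N.
  have L1 : (0 < L)%N by rewrite divn_gt0.
  have := divn_eq n c; have := ltn_pmod n c0; rewrite -/L; nia.
have nLF : n%:R ^+ 2 <= (L * L)%:R * (2 * c%:R) ^+ 2 :> F.
  have -> : (L * L)%:R * (2 * c%:R) ^+ 2 = (L%:R * (2 * c%:R)) ^+ 2 :> F.
    by rewrite natrM [RHS]exprMn (expr2 L%:R).
  rewrite lerXn2r ?nnegrE ?mulr_ge0 //.
  by rewrite -[2]/(2%:R) -!natrM ler_nat.
have LLq : t%:R / e <= (L * L)%:R * q n.
  have := le_trans hn (ler_wpM2r qn0 nLF).
  by rewrite [X in _ <= X -> _]mulrAC ler_pM2r // exprn_gt0 // mulr_gt0.
apply: le_trans (_ : t%:R * (1 + (L * L)%:R * q n)^-1 <= _).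
  by rewrite ler_wpM2l // one_sub_exp_le.
have pos : 0 < 1 + (L * L)%:R * q n by rewrite ltr_wpDr // mulr_ge0.
rewrite ler_pdivrMr // mulrDr mulr1.
have := ler_wpM2l (ltW e0) LLq; rewrite mulrCA divff ?gt_eqF // mulr1 => h'.
by rewrite (le_trans h') // lerDr ltW.
Qed.

End Limits.

Lemma cvg_sum0 (F : realType) (I : finType) (f : I -> nat -> F) :
  (forall i, f i n @[n --> \oo] --> (0 : F)) ->
  \sum_i f i n @[n --> \oo] --> (0 : F).
Proof.
move=> f0; elim: (index_enum I) => [|i s IH].
  by under eq_fun do rewrite big_nil; exact: cvg_cst.
under eq_fun do rewrite big_cons.
by have := cvgD (f0 i) IH; rewrite addr0; apply.
Qed.

(** * The zero-one law *)

Theorem theorem1p2 (R : realType) (p : nat -> R)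
  (p01 : forall n : nat, 0 <= p n <= 1)
  (hp : forall k : nat, (1 <= k)%N ->
    ((((n%:R `^ (2 / k%:R) * p n)%:E @[n --> \oo] --> 0%E)
      \/ ((n%:R `^ (2 / k%:R) * p n)%:E @[n --> \oo] --> +oo%E))
     /\ (((n%:R `^ (2 / k%:R) * (1 - p n))%:E @[n --> \oo] --> 0%E)
      \/ ((n%:R `^ (2 / k%:R) * (1 - p n))%:E @[n --> \oo] --> +oo%E))))
  (A : formula) (hA : sentence A) :
  (Prob n (p n) A @[n --> \oo] --> (0 : R))
  \/ (Prob n (p n) A @[n --> \oo] --> (1 : R)).
Proof.
have p0 n : 0 <= p n by case/andP: (p01 n).
have q0 n : 0 <= 1 - p n by rewrite subr_ge0; case/andP: (p01 n).
pose r := radius A; pose T := width A; pose c := (T.+1 * r.*2.+1)%N.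
have dich (P : pattern r) :
    zero_or_infinite (fun n => n%:R ^+ 2 * pattern_pr (p n) P).
  under [X in zero_or_infinite X]eq_fun do rewrite pattern_prE.
  apply: zero_or_infinite_mul => //.
  (* A color missing from [P] contributes the factor [1], leaving [n^2]. *)
  - case: #|_| => [|a].
      by right; under eq_fun do rewrite mulr1; exact: sqr_natr_cvgy.
    by apply: zero_or_infinite_power => //; case: (hp a.+1 isT).
  - case: #|_| => [|a].
      by right; under eq_fun do rewrite mulr1; exact: sqr_natr_cvgy.
    by apply: zero_or_infinite_power => //; case: (hp a.+1 isT).
pose S : {set pattern r} := [set P | `[<
  n%:R ^+ 2 * pattern_pr (p n) P @[n --> \oo] --> +oo >]]%SET.
pose beta n := \sum_P if P \in S
  then T.+1%:R * (1 - pattern_pr (p n) P) ^+ (n %/ c * (n %/ c))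
  else n%:R ^+ 2 * pattern_pr (p n) P.
have beta0 : beta n @[n --> \oo] --> (0 : R).
  apply: cvg_sum0 => P; case: (boolP (P \in S)); rewrite inE.
    move=> /asboolP PS; apply: blocks_cvg0 => // n.
    by rewrite pattern_pr_ge0 ?pattern_pr_le1.
  by move=> /asboolPn PS; case: (dich P).
pose G m : pred (image m.+1) := @typical r T (m.+1 %/ c) S m.
have hc m : (T.+1 * (m.+1 %/ c) * r.*2.+1 <= m.+1)%N.
  by rewrite mulnAC mulnC leq_trunc_div.
have prG m : (r.*2 <= m)%N -> pr (p m.+1) (predC (G m)) <= beta m.+1.
  by move=> rm; exact: pr_not_typical.
(* Typical images of all sizes agree on [A], in both directions. *)
have transfer m m' (eta : image m.+1) (eta' : image m'.+1) :
    (r.*2 <= m)%N -> (r.*2 <= m')%N -> G m eta -> G m' eta' ->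
    models eta A -> models eta' A.
  move=> rm rm' g g'.
  apply: (@models_extends r T) => //; try by lia.
  - exact: typical_extends (hc m') g g'.
  - exact: typical_extends (hc m) g' g.
have pr_le n (D E : pred (image n)) : (forall eta, D eta -> E eta) ->
    pr (p n) D <= pr (p n) E.
  move=> DE; rewrite /pr [leLHS]big_mkcond [leRHS]big_mkcond /=.
  apply: ler_sum => eta _; have := mu_ge0 (p01 n) eta.
  by case: (boolP (D eta)) => [/DE ->|_ ?] //; case: ifP.
pose M n : pred (image n) := fun eta => `[< models eta A >].
have large : \forall n \near \oo, (r.*2 < n)%N by exact: nbhs_infty_ge.
have [[m [eta [rm g mA]]]|none] :=
  pselect (exists m (eta : image m.+1),
             [/\ (r.*2 <= m)%N, G m eta & models eta A]).
  right; apply: (@squeeze_cvgr _ _ _ _ (fun n => 1 - beta n) (fun=> 1)).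
  - apply: filterS large => -[//|m'] rm'.
    rewrite -[Prob _ _ _]/(pr (p m'.+1) (M m'.+1)) prC.
    rewrite gerBl pr_ge0 // andbT lerB // (le_trans _ (prG m' rm')) // pr_le //.
    move=> eta' /= /asboolP nA; apply/negP => g'; apply: nA.
    exact: transfer g g' mA.
  - by have := cvgB (cvg_cst (1 : R)) beta0; rewrite subr0; apply.
  - exact: cvg_cst.
left; apply: (@squeeze_cvgr _ _ _ _ (fun=> 0) beta) => //; last exact: cvg_cst.
apply: filterS large => -[//|m] rm.
rewrite -[Prob _ _ _]/(pr (p m.+1) (M m.+1)) pr_ge0 //=.
rewrite (le_trans _ (prG m rm)) // pr_le // => eta /asboolP mA.
by apply/negP => g; apply: none; exists m, eta.
Qed.
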